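(* Let $k$ be an algebraically closed field, $A=k^{[2]}$, and let $F\in A$ be a pseudo field generator in $A$. Then $F$ is a good pseudo field generator in $A$ if and only if $F$ has at least one purely inseparable dicritical.
   Context: $k^{[2]}$ is a polynomial ring in two variables over $k$. $F$ is a pseudo field generator in $A$ if there exists $G\in\operatorname{Frac}A$ such that $\operatorname{Frac}A$ is purely inseparable over $k(F,G)$; it is good if such $G$ can be chosen in $A$. For a field $E$ contained in a domain $B$, $\mathbb P(B/E)$ denotes the set of valuation rings $\mathcal O$ with $E\subseteq\mathcal O\subsetneq\operatorname{Frac}B$ and $\operatorname{Frac}\mathcal O=\operatorname{Frac}B$, and $\mathbb P_\infty(B/E)=\{\mathcal O\in\mathbb P(B/E): B\not\subseteq\mathcal O\}$. For $F\in A\setminus k$, let $\mathcal A=S^{-1}A$ with $S=k[F]\setminus\{0\}$; the dicriticals of $F$ are the elements of $\mathbb P_\infty(\mathcal A/k(F))$. A dicritical is purely inseparable if its residue field is a purely inseparable extension of $k(F)$. *)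

(* Defs.v *)
From HB Require Import structures.
From mathcomp Require Import all_boot all_order all_algebra.
Set Implicit Arguments. Unset Strict Implicit. Unset Printing Implicit Defensive.
Import GRing.Theory.
Local Open Scope ring_scope.

Definition polyA (k : fieldType) := {poly {poly k}}.
Definition fracA (k : fieldType) := {fraction {poly {poly k}}}.
Definition toF (k : fieldType) (a : {poly {poly k}}) : fracA k :=
  @FracField.tofrac _ a.

Definition kconst (k : fieldType) (y : fracA k) : Prop :=
  exists c : k, y = toF (c%:P%:P).

Definition subfield_closed (L : fieldType) (S : L -> Prop) : Prop :=
  S 1 /\ (forall x y, S x -> S y -> S (x - y) /\ S (x * y)) /\
  (forall x, S x -> S x^-1).

Definition genfield (L : fieldType) (E : L -> Prop) (x : L) : Prop :=
  forall S : L -> Prop, subfield_closed S -> (forall y, E y -> S y) -> S x.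

Definition kFG (k : fieldType) (F G : {poly {poly k}}) : fracA k -> Prop :=
  genfield (fun y => kconst y \/ y = toF F \/ y = toF G).
Definition kF (k : fieldType) (F : {poly {poly k}}) : fracA k -> Prop :=
  genfield (fun y => kconst y \/ y = toF F).

(* every element x of D is purely inseparable over K modulo the subset I:
   some x^(p^e) is congruent to an element of K modulo I, where p = 1 or p is
   the characteristic.  With I = {0} this is pure inseparability of a field
   over a subfield; with I the maximal ideal of a valuation ring O it is pure
   inseparability of the residue field O/m over the image of K. *)
Definition pure_insep_mod (L : fieldType) (D K I : L -> Prop) : Prop :=
  forall x, D x -> exists (p e : nat), (p = 1%N \/ p \in [pchar L]) /\
    exists c, K c /\ I (x ^+ (p ^ e)%N - c).

Definition frac_pure_insep (k : fieldType) (K : fracA k -> Prop) : Prop :=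
  pure_insep_mod (fun _ => True) K (fun z => z = 0).

Definition pseudo_field_generator (k : fieldType) (F : {poly {poly k}}) : Prop :=
  exists G : fracA k,
    frac_pure_insep (genfield (fun y => kconst y \/ y = toF F \/ y = G)).

Definition good_pseudo_field_generator (k : fieldType) (F : {poly {poly k}}) : Prop :=
  exists G : {poly {poly k}}, frac_pure_insep (kFG F G).

Definition valuation_ring (L : fieldType) (O : L -> Prop) : Prop :=
  O 0 /\ O 1 /\ (forall x y, O x -> O y -> O (x - y) /\ O (x * y)) /\
  (forall x, x != 0 -> O x \/ O x^-1).

Definition val_max_ideal (L : fieldType) (O : L -> Prop) (x : L) : Prop :=
  O x /\ (x = 0 \/ ~ O x^-1).

Definition in_kF_poly (k : fieldType) (F s : {poly {poly k}}) : Prop :=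
  exists q : {poly k}, s = (map_poly (fun c : k => c%:P%:P) q).[F].

Definition locA (k : fieldType) (F : {poly {poly k}}) (x : fracA k) : Prop :=
  exists a s : {poly {poly k}}, in_kF_poly F s /\ s != 0 /\ x = toF a / toF s.

Definition dicritical (k : fieldType) (F : {poly {poly k}}) (O : fracA k -> Prop) : Prop :=
  valuation_ring O /\ (forall y, kF F y -> O y) /\ (exists z, ~ O z) /\
  (exists z, locA F z /\ ~ O z).

Definition purely_insep_dicritical (k : fieldType) (F : {poly {poly k}}) (O : fracA k -> Prop) : Prop :=
  dicritical F O /\ pure_insep_mod O (kF F) (val_max_ideal O).

(* Main.v *)
Require Import Defs.
From mathcomp Require Import all_boot all_order all_algebra.
From HB Require Import structures.
From mathcomp Require Import polyXY boolp ring zify.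
Set Implicit Arguments. Unset Strict Implicit. Unset Printing Implicit Defensive.
Import GRing.Theory.
Local Open Scope ring_scope.

(* Let K = k(F) and L = Frac A.

   If L is purely inseparable over K(G) with G in A, then G is transcendental
   over K, and the degree place of K(G) extends to L by taking p-power roots;
   G has a pole there and the residue field is purely inseparable over K.

   Conversely, let O be a purely inseparable dicritical and L be purely
   inseparable over K(G).  Replacing G by 1/(G^q - c), where c in K is the
   residue of G^q, one may assume that G has a pole at O.  Choose a in S^-1 A
   outside O and q with a^q = u(G)/v(G); then deg u > deg v, as otherwise a^q
   would be in O, so the equation u(T) - a^q v(T) = 0 shows that G is integral
   over S^-1 A.  Since A is integrally closed, s G is in A for some s in S. *)

(** * Powers of the characteristic exponent *)

(* q is a power of the characteristic exponent of R. *)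
Definition pexp (R : nzRingType) (q : nat) : Prop :=
  exists p e : nat, (p = 1%N \/ p \in [pchar R]) /\ q = (p ^ e)%N.

Lemma pexp_gt0 (R : nzRingType) q : pexp R q -> (0 < q)%N.
Proof.
move=> [p [e [pP ->]]]; rewrite expn_gt0; case: pP => [->//|/pcharf_prime pp].
by rewrite prime_gt0.
Qed.

Lemma pexp1 (R : nzRingType) : pexp R 1.
Proof. by exists 1%N, 0%N; split; [left|]. Qed.

Lemma pexpM (R : nzRingType) q r : pexp R q -> pexp R r -> pexp R (q * r).
Proof.
move=> [p [e [pP ->]]] [p' [e' [pP' ->]]].
case: pP pP' => [->|cp].
  by move=> pP'; exists p', e'; split=> //; rewrite exp1n mul1n.
case=> [->|cp']; first by exists p, e; split; [right|rewrite exp1n muln1].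
exists p, (e + e')%N; split; first by right.
(* A ring has at most one prime characteristic, so p' = p. *)
by move: cp'; rewrite (pcharf_eq cp) => /eqnP->; rewrite expnD.
Qed.

Lemma pexpB (R : comNzRingType) q (x y : R) :
  pexp R q -> (x - y) ^+ q = x ^+ q - y ^+ q.
Proof.
move=> [p [e [pP ->]]]; case: pP => [->|cp]; first by rewrite exp1n !expr1.
elim: e => [|e IHe]; first by rewrite !expr1.
by rewrite expnSr !exprM IHe -!(pFrobenius_autE cp) rmorphB.
Qed.

(** * Subfields and generated subfields *)

Lemma subfieldX (L : fieldType) (S : L -> Prop) x n :
  subfield_closed S -> S x -> S (x ^+ n).
Proof.
move=> [S1 [SBM _]] Sx; elim: n => [//|n IHn].
by rewrite exprS; case: (SBM _ _ Sx IHn).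
Qed.

Lemma subfieldD (L : fieldType) (S : L -> Prop) x y :
  subfield_closed S -> S x -> S y -> S (x + y).
Proof.
move=> [S1 [SBM _]] Sx Sy; have [S0 _] := SBM _ _ S1 S1.
have [SN _] := SBM _ _ S0 Sy; have [+ _] := SBM _ _ Sx SN.
by rewrite subrr sub0r opprK.
Qed.

Lemma subfieldM (L : fieldType) (S : L -> Prop) x y :
  subfield_closed S -> S x -> S y -> S (x * y).
Proof. by move=> [S1 [SBM _]] Sx Sy; case: (SBM _ _ Sx Sy). Qed.

Lemma subfieldV (L : fieldType) (S : L -> Prop) x :
  subfield_closed S -> S x -> S x^-1.
Proof. by move=> [_ [_ ]]; apply. Qed.

Lemma genfield_subfield (L : fieldType) (E : L -> Prop) :
  subfield_closed (genfield E).
Proof.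
split; first by move=> S [].
split=> [x y gx gy|x gx].
  by split=> S SS ES; case: (SS) => _ [/(_ x y (gx S SS ES) (gy S SS ES)) [] ].
by move=> S SS ES; case: (SS) => _ [_ ]; apply; apply: gx.
Qed.

Lemma genfield_id (L : fieldType) (E : L -> Prop) x : E x -> genfield E x.
Proof. by move=> Ex S _; apply. Qed.

Lemma genfield_sub (L : fieldType) (E S : L -> Prop) :
  subfield_closed S -> (forall x, E x -> S x) -> forall x, genfield E x -> S x.
Proof. by move=> SS ES x; apply. Qed.

Lemma genfield_mono (L : fieldType) (E E' : L -> Prop) x :
  (forall y, E y -> E' y) -> genfield E x -> genfield E' x.
Proof.
move=> EE' gx; apply: (genfield_sub (genfield_subfield E') _ gx) => y /EE' E'y.
exact: genfield_id.
Qed.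

(** The boolean form of the generated subfield lets it carry the field structure of [gensub], over
    which polynomials can be formed. *)
Definition genfield_pred (L : fieldType) (E : L -> Prop) : {pred L} :=
  [pred x | `[< genfield E x >]].

Fact genfield_pred_divring (L : fieldType) (E : L -> Prop) : divring_closed (genfield_pred E).
Proof.
have [g1 [gBM gV]] := genfield_subfield E.
split=> [|x y|x y]; rewrite !inE; first exact/asboolP.
  by move=> /asboolP gx /asboolP gy; apply/asboolP; case: (gBM x y).
move=> /asboolP gx /asboolP /gV gy; apply/asboolP.
by case: (gBM x y^-1).
Qed.

HB.instance Definition _ (L : fieldType) (E : L -> Prop) :=
  GRing.isDivringClosed.Build L (genfield_pred E) (genfield_pred_divring E).

Record gensub (L : fieldType) (E : L -> Prop) := GenSub {
  gsval :> L; gsvalP : gsval \in genfield_pred E }.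

HB.instance Definition _ (L : fieldType) (E : L -> Prop) :=
  [isSub of gensub E for @gsval L E].
HB.instance Definition _ (L : fieldType) (E : L -> Prop) :=
  [Choice of gensub E by <:].
HB.instance Definition _ (L : fieldType) (E : L -> Prop) :=
  [SubChoice_isSubIntegralDomain of gensub E by <:].
HB.instance Definition _ (L : fieldType) (E : L -> Prop) :=
  [SubIntegralDomain_isSubField of gensub E by <:].

Lemma gsval_in (L : fieldType) (E : L -> Prop) (c : gensub E) : genfield E (val c).
Proof. by have := gsvalP c; rewrite inE => /asboolP. Qed.

Lemma in_gsval (L : fieldType) (E : L -> Prop) x :
  genfield E x -> exists c : gensub E, x = val c.
Proof.
move=> gx; have xE : x \in genfield_pred E by rewrite inE; exact: (asboolT gx).
by exists (GenSub xE).
Qed.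

(** * Simple extensions K(g) as values of rational functions *)

Section RationalValues.
Variables (K L : fieldType) (i : {rmorphism K -> L}) (g : L).

(** The condition is on the value of v at g, not on v, so this is K(g) also when g is algebraic over
    K. *)
Definition ratval (x : L) : Prop :=
  exists u v : {poly K}, (map_poly i v).[g] != 0 /\
    x = (map_poly i u).[g] / (map_poly i v).[g].

Lemma ratval_subfield : subfield_closed ratval.
Proof.
split; first by exists 1, 1; rewrite rmorph1 hornerE oner_eq0 divr1.
split=> [x y [u [v [v0 ->]]] [u' [v' [v0' ->]]]|x [u [v [v0 ->]]]].
  split.
    exists (u * v' - u' * v), (v * v').
    rewrite !(rmorphB, rmorphM) !hornerE mulf_neq0//; split=> //.
    by rewrite -mulNr addf_div // mulNr.
  by exists (u * u'), (v * v'); rewrite !rmorphM !hornerM mulf_neq0// mulf_div.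
have [->|u0] := eqVneq (map_poly i u).[g] 0.
  by exists 0, 1; rewrite mul0r invr0 rmorph0 rmorph1 !hornerE oner_eq0.
by exists v, u; rewrite invf_div.
Qed.

Lemma ratval_const c : ratval (i c).
Proof.
by exists c%:P, 1; rewrite rmorph1 map_polyC !hornerE oner_eq0 divr1.
Qed.

Lemma ratval_gen : ratval g.
Proof. by exists 'X, 1; rewrite rmorph1 map_polyX !hornerE oner_eq0 divr1. Qed.

End RationalValues.

(** * Valuation rings *)

Section ValuationRing.
Variables (L : fieldType) (O : L -> Prop).
Hypothesis valO : valuation_ring O.

Lemma val_ring0 : O 0. Proof. by case: valO. Qed.
Lemma val_ring1 : O 1. Proof. by case: valO => _ []. Qed.
Lemma val_ringB x y : O x -> O y -> O (x - y).
Proof. by case: valO => _ [_ [BM _]] Ox Oy; case: (BM x y). Qed.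
Lemma val_ringM x y : O x -> O y -> O (x * y).
Proof. by case: valO => _ [_ [BM _]] Ox Oy; case: (BM x y). Qed.
Lemma val_ringD x y : O x -> O y -> O (x + y).
Proof.
by move=> Ox Oy; rewrite -[y]opprK -[- y]add0r; do 2?apply: val_ringB => //; apply: val_ring0.
Qed.
Lemma val_ringX x n : O x -> O (x ^+ n).
Proof.
move=> Ox; elim: n => [|n IHn]; first exact: val_ring1.
by rewrite exprS; apply: val_ringM.
Qed.

Lemma notin_val_ring_neq0 x : ~ O x -> x != 0.
Proof. by move=> nOx; apply/eqP => x0; apply: nOx; rewrite x0; apply: val_ring0. Qed.

Lemma notin_val_ring_inv x : ~ O x -> O x^-1.
Proof.
by move=> nOx; case: valO => _ [_ [_ /(_ x (notin_val_ring_neq0 nOx))]] [].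
Qed.

(** If x were outside O, then 1/x would be in O, and so would x = x^n (1/x)^(n-1). *)
Lemma val_ring_root x n : (0 < n)%N -> O (x ^+ n) -> O x.
Proof.
case: n => // n _ Oxn; case: (EM (O x)) => // nOx.
have x0 := notin_val_ring_neq0 nOx.
suff -> : x = x ^+ n.+1 * x^-1 ^+ n by apply/val_ringM/val_ringX/notin_val_ring_inv.
by rewrite exprS exprVn mulfK // expf_neq0.
Qed.

End ValuationRing.

(* A valuation ring is local: a sum of two nonunits is a nonunit. *)
Lemma val_ring_unitD (L : fieldType) (O : L -> Prop) a b :
  valuation_ring O -> O a -> O b -> a + b != 0 -> O (a + b)^-1 ->
  (a != 0 /\ O a^-1) \/ (b != 0 /\ O b^-1).
Proof.
move=> vO Oa Ob ab0 Oab.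
have [a0|a0] := eqVneq a 0; first by right; move: ab0 Oab; rewrite a0 add0r.
have [b0|b0] := eqVneq b 0; first by left; move: Oab; rewrite b0 addr0.
have [_ [_ [_ /(_ (a / b))]]] := vO.
case; first by rewrite mulf_neq0 ?invr_eq0.
  move=> Oab'; right; split=> //.
  suff -> : b^-1 = (a + b)^-1 * (a / b + 1).
    by apply: val_ringM => //; apply: val_ringD => //; apply: val_ring1.
  by rewrite -[1](mulfV b0) -mulrDl mulKf.
rewrite invf_div => Oba; left; split=> //.
suff -> : a^-1 = (a + b)^-1 * (1 + b / a).
  by apply: val_ringM => //; apply: val_ringD => //; apply: val_ring1.
by rewrite -[1](mulfV a0) -mulrDl mulKf.
Qed.

(** * Polynomials in an element with a pole *)

Section Infinity.
Variables (K L : fieldType) (i : {rmorphism K -> L}) (g : L) (O : L -> Prop).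
Hypotheses (vO : valuation_ring O) (iO : forall c, O (i c)) (gO : ~ O g).

Let g0 : g != 0. Proof. exact: (notin_val_ring_neq0 vO). Qed.

(** The quotient is a polynomial in 1/g with coefficients in K, and 1/g is in O. *)
Lemma val_poly_div (p : {poly K}) n :
  (size p <= n.+1)%N -> O ((map_poly i p).[g] / g ^+ n).
Proof.
move=> sp; rewrite (@horner_coef_wide _ n.+1); last by rewrite size_map_poly.
rewrite big_distrl /=.
apply: big_ind => [|x y Ox Oy|j _]; first exact: val_ring0.
  exact: val_ringD.
rewrite coef_map -mulrA; apply: val_ringM => //; first exact: iO.
have jn : (j <= n)%N by rewrite -ltnS.
suff -> : g ^+ j / g ^+ n = g^-1 ^+ (n - j) by apply: val_ringX => //; apply: notin_val_ring_inv.
by rewrite -[in g ^+ n](subnK jn) exprD invfM mulrC -mulrA mulVf ?mulr1 ?expf_neq0 ?exprVn.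
Qed.

(** The leading coefficient is a unit of O and equals p(g)/g^n - r(g)/g^n with deg r < n, so one of
    the two terms is a unit. It is not the second: otherwise g, the quotient of r(g)/g^(n-1) by
    r(g)/g^n, would be in O. *)
Lemma val_poly_lead (p : {poly K}) :
  p != 0 -> O (g ^+ (size p).-1 / (map_poly i p).[g]).
Proof.
move=> p0; set n := (size p).-1.
have sp : size p = n.+1 by rewrite prednK // size_poly_gt0.
set r := p - lead_coef p *: 'X^n.
have sr : (size r <= n)%N.
  apply/leq_sizeP => j; rewrite leq_eqVlt coefB coefZ coefXn => /predU1P[<-|nj].
    by rewrite eqxx mulr1 lead_coefE subrr.
  by rewrite gtn_eqF // mulr0 subr0 nth_default // sp.
have Ew : i (lead_coef p) = (map_poly i p).[g] / g ^+ n - (map_poly i r).[g] / g ^+ n.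
  rewrite -mulrBl rmorphB /= map_polyZ /= map_polyXn !hornerE opprB addrC subrK.
  by rewrite mulfK ?expf_neq0.
have c0 : i (lead_coef p) != 0 by rewrite fmorph_eq0 lead_coef_eq0.
have Oci : O (i (lead_coef p))^-1 by rewrite -fmorphV.
rewrite Ew in c0 Oci.
case: (val_ring_unitD vO _ _ c0 Oci) => [||[_]|[y0]].
- by apply: val_poly_div; rewrite sp.
- by rewrite -sub0r; apply: val_ringB (val_ring0 vO) _ => //; apply: val_poly_div; apply: leqW.
- by rewrite invf_div.
have r0 : r != 0.
  by apply: contraNneq y0 => ->; rewrite rmorph0 horner0 mul0r oppr0.
have nE : n = n.-1.+1.
  by rewrite prednK //; apply: leq_trans sr; rewrite size_poly_gt0.
have rg0 : (map_poly i r).[g] != 0.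
  by apply: contraNneq y0 => ->; rewrite mul0r oppr0.
move=> Oy; case: gO.
have -> : g = (map_poly i r).[g] / g ^+ n.-1 * - (- ((map_poly i r).[g] / g ^+ n))^-1.
  rewrite invrN opprK invf_div [in g ^+ n]nE exprS.
  by field; rewrite rg0 expf_neq0.
apply: val_ringM => //; first by apply: val_poly_div; rewrite -nE.
by rewrite -sub0r; apply: val_ringB => //; apply: val_ring0.
Qed.

(** If deg u <= deg v = m, then u(g)/g^m and g^m/v(g) are both in O, and so is their product. *)
Lemma val_pole_size (u v : {poly K}) :
  (map_poly i v).[g] != 0 -> ~ O ((map_poly i u).[g] / (map_poly i v).[g]) ->
  (size v < size u)%N.
Proof.
move=> v0 nO; rewrite ltnNge; apply/negP => suv; apply: nO.
have v_neq0 : v != 0 by apply: contraNneq v0 => ->; rewrite rmorph0 horner0.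
have gn0 : g ^+ (size v).-1 != 0 by rewrite expf_neq0.
rewrite -[X in X / _](divfK gn0) -mulrA; apply: val_ringM => //.
  by apply: val_poly_div; rewrite prednK ?size_poly_gt0.
exact: val_poly_lead.
Qed.

End Infinity.

(* The polynomial u - x v has the degree and the leading coefficient of u. *)
Lemma pole_integral (K L : fieldType) (i : {rmorphism K -> L}) (g x : L)
    (u v : {poly K}) : (size v < size u)%N -> (map_poly i v).[g] != 0 ->
  x = (map_poly i u).[g] / (map_poly i v).[g] ->
  exists p : {poly L}, [/\ p \is monic, root p g &
    forall j, exists c d : K, p`_j = i c + i d * x].
Proof.
move=> suv v0 Ex.
have u0 : lead_coef u != 0.
  by rewrite lead_coef_eq0 -size_poly_gt0; apply: leq_trans suv.
exists (i (lead_coef u)^-1 *: (map_poly i u - x *: map_poly i v)); split.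
- rewrite monicE lead_coefZ lead_coefDl ?size_map_poly.
    by rewrite lead_coef_map fmorphV mulVf // fmorph_eq0.
    rewrite size_polyN. apply: leq_ltn_trans (size_scale_leq _ _) _.
    by rewrite size_map_poly.
- by rewrite rootE !hornerE Ex divfK // subrr mulr0.
- move=> j; exists ((lead_coef u)^-1 * u`_j), (- ((lead_coef u)^-1 * v`_j)).
  by rewrite coefZ coefB coefZ !coef_map /= rmorphN !rmorphM /= fmorphV; ring.
Qed.

(** * Integral closedness of k[X][Y] *)

Lemma fraction_quotient (R : idomainType) (H : {fraction R}) :
  exists a b : R, b != 0 /\ H = FracField.tofrac a / FracField.tofrac b.
Proof.
elim/quotP: H => x /=; have x0 := denom_ratioP x.
exists \n_x, \d_x; split=> //.
have tx0 : FracField.tofrac \d_x != 0 by rewrite tofrac_eq0.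
apply: (canRL (mulfK tx0)).
unlock FracField.tofrac; rewrite -[LHS]FracField.pi_mul.
apply/eqmodP; rewrite /= FracField.equivfE /FracField.mulf.
by rewrite !numden_Ratio ?(oner_neq0, mul1r, mulr1) //= mulrC.
Qed.

Lemma frac_rearrange (L : fieldType) (p a b c d : L) :
  c != 0 -> p * (a / c) * (c * (b * d)) = b * (p * a * d).
Proof. by move=> c0; field. Qed.

(** Multiplying a monic equation of degree n for a/b by b^n leaves a^n plus terms divisible by b. *)
Lemma integral_dvd_exp (R : idomainType) (a b : R) : b != 0 ->
  integralOver (@FracField.tofrac R) (FracField.tofrac a / FracField.tofrac b) ->
  exists n c, a ^+ n = b * c.
Proof.
move=> b0 [p mp /rootP pz].
have tb0 : FracField.tofrac b != 0 by rewrite tofrac_eq0.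
have sp : size p = (size p).-1.+1 by rewrite prednK // size_poly_gt0 monic_neq0.
set n := (size p).-1 in sp; exists n.
exists (- \sum_(j < n) p`_j * a ^+ j * b ^+ (n - j).-1).
have pn : p`_n = 1 by apply/eqP; rewrite -monicE.
apply/eqP; rewrite -tofrac_eq; apply/eqP.
have := congr1 (fun z => z * FracField.tofrac b ^+ n) pz.
rewrite mul0r (@horner_coef_wide _ n.+1) ?(leq_trans (size_poly _ _)) ?sp //.
rewrite big_ord_recr /= coef_map /= pn rmorph1 mul1r expr_div_n mulrDl divfK ?expf_neq0 //.
move/eqP; rewrite addrC addr_eq0 rmorphXn => /eqP ->.
rewrite rmorphM rmorphN rmorph_sum /= mulrN; congr (- _).
rewrite big_distrl big_distrr /=; apply: eq_bigr => j _.
rewrite coef_map /= !rmorphM !rmorphXn /= expr_div_n.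
have -> : FracField.tofrac b ^+ n = FracField.tofrac b ^+ j *
    (FracField.tofrac b * FracField.tofrac b ^+ (n - j).-1).
  by rewrite -exprS prednK ?subn_gt0 // -exprD subnKC // ltnW.
by apply: frac_rearrange; rewrite expf_neq0.
Qed.

(* As k is algebraically closed, the denominator splits into factors X - x;
   evaluating at x shows that each of them divides the numerator. *)
Lemma integral_poly_const (k : closedFieldType) (H : {fraction {poly {poly k}}})
    (s : {poly k}) (a : {poly {poly k}}) :
  integralOver (@FracField.tofrac {poly {poly k}}) H -> s != 0 ->
  H = FracField.tofrac a / FracField.tofrac s%:P ->
  exists a' : {poly {poly k}}, H = FracField.tofrac a'.
Proof.
move=> intH; have [m] := ubnP (size s).
elim: m s a => // m IHm s a; rewrite ltnS => sm s0 EH.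
have [s1|s1] := leqP (size s) 1.
  have [c c0 sE] : exists2 c, c != 0 & s = c%:P.
    by exists s`_0; [rewrite -polyC_eq0|]; rewrite -size1_polyC.
  exists (c^-1%:P%:P * a).
  rewrite EH; apply: (canLR (mulfK _)); first by rewrite tofrac_eq0 polyC_eq0.
  by rewrite -rmorphM /= mulrC sE mulrA -!polyCM mulfV // mul1r.
have [x] := closed_rootP s (negbT (gtn_eqF s1)).
move=> /factor_theorem [t Es].
have t0 : t != 0 by apply: contraNneq s0 => t0; rewrite Es t0 mul0r.
have ax : map_poly (horner_eval x) a = 0.
  have [||n [c E]] := @integral_dvd_exp _ a s%:P.
  - by rewrite polyC_eq0.
  - by rewrite -EH.
  have := congr1 (map_poly (horner_eval x)) E.
  rewrite rmorphXn rmorphM /= map_polyC /= /horner_eval Es hornerM hornerXsubC.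
  by rewrite subrr mulr0 mul0r => /eqP; rewrite expf_eq0 => /andP[_ /eqP].
(* All coefficients of [a] vanish at x, so dividing each of them by X - x is exact. *)
have [a' Ea] : exists a', a = ('X - x%:P)%:P * a'.
  exists (map_poly (fun c => c %/ ('X - x%:P)) a).
  apply/polyP => j; rewrite coefCM coef_map_id0 ?div0p // mulrC divpK //.
  rewrite dvdp_XsubCl; apply/rootP.
  by have := congr1 (fun p : {poly k} => p`_j) ax; rewrite coef_map coef0.
have st : (size t < m)%N.
  by move: sm; rewrite Es size_mul ?polyXsubC_eq0 // size_XsubC addn2.
apply: (IHm t a' st t0).
have Es' : s%:P = ('X - x%:P)%:P * t%:P by rewrite Es mulrC polyCM.
rewrite EH Ea Es' !tofracM -mulf_div divff ?mul1r //.
by rewrite tofrac_eq0 polyC_eq0 polyXsubC_eq0.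
Qed.

(** Cancelling the gcd with respect to Y costs factors [ca], [cb] in k[X]. The reduced denominator
    [b1] divides a power of a multiple of [a1], to which it is coprime over k(X), so it has Y-degree
    0. This leaves a denominator in k[X]. *)
Lemma integral_poly_frac (k : closedFieldType) (H : {fraction {poly {poly k}}}) :
  integralOver (@FracField.tofrac {poly {poly k}}) H ->
  exists a : {poly {poly k}}, H = FracField.tofrac a.
Proof.
move=> intH; have [a [b [b0 EH]]] := fraction_quotient H.
have g0 : gcdp a b != 0 by rewrite gcdp_eq0 negb_and b0 orbT.
have cop : coprimep (a %/ gcdp a b) (b %/ gcdp a b).
  by apply: coprimep_div_gcd; rewrite b0 orbT.
have Ea := Pdiv.Idomain.divpK (dvdp_gcdl a b).
have Eb := Pdiv.Idomain.divpK (dvdp_gcdr a b).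
move: cop Ea Eb; set a1 := a %/ _; set b1 := b %/ _; move: (gcdp a b) g0 => g g0.
set ca := _ ^+ _; set cb := _ ^+ _ => cop Ea Eb.
have ca0 : ca != 0 by rewrite expf_neq0 // lead_coef_eq0.
have cb0 : cb != 0 by rewrite expf_neq0 // lead_coef_eq0.
have b10 : b1 != 0.
  apply: contraNneq b0 => b1_0; move/eqP: Eb; rewrite b1_0 mul0r eq_sym scale_poly_eq0.
  by rewrite (negPf cb0).
(* As [a1 * g = ca *: a] and [b1 * g = cb *: b], the factors change sides when g is cancelled. *)
have EH' : H = FracField.tofrac (cb *: a1) / FracField.tofrac (ca *: b1).
  apply/eqP; rewrite EH eqr_div ?tofrac_eq0 ?scale_poly_eq0 ?(negPf ca0) //.
  rewrite -!tofracM tofrac_eq; apply/eqP/(mulIf g0).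
  rewrite -!mul_polyC in Ea Eb *.
  rewrite -!mulrA Eb [b * g]mulrC (mulrA a1) Ea -[in RHS]mulrA.
  by rewrite [LHS]mulrCA (mulrCA a) [LHS]mulrCA.
have [||n [c E]] := @integral_dvd_exp _ (cb *: a1) (ca *: b1).
- by rewrite scale_poly_eq0 negb_or ca0.
- by rewrite -EH'.
have sb1 : size b1 == 1%N.
  rewrite -coprimepp; apply: (@coprimep_dvdl _ ((cb *: a1) ^+ n)).
    by rewrite E -mul_polyC -mulrA dvdp_mull // dvdp_mulr // dvdpp.
  by apply: coprimep_expr; rewrite coprimepZr // coprimep_sym.
have [d d0 b1E] := size_poly1P _ sb1.
apply: (@integral_poly_const _ H (ca * d) (cb *: a1)) => //.
  by rewrite mulf_neq0.
by rewrite EH' b1E polyCM mul_polyC.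
Qed.

(** * Fractions with restricted numerators and denominators *)

Section Quotients.
Variables (R : idomainType) (L : fieldType) (f : {rmorphism R -> L}).
Hypothesis f_inj : injective f.
Variable S : R -> Prop.
Hypotheses (S1 : S 1) (SB : forall s t, S s -> S t -> S (s - t)).
Hypothesis SM : forall s t, S s -> S t -> S (s * t).

(** For S = k[F], taking N = S gives k(F), and taking all of A for N gives the localization of A at
    the nonzero elements of k[F]. *)
Definition quotient (N : R -> Prop) (x : L) :=
  exists a s, [/\ N a, S s, s != 0 & x = f a / f s].

Let f_eq0 a : (f a == 0) = (a == 0).
Proof. by rewrite -(rmorph0 f) (inj_eq f_inj). Qed.

Lemma quotient_id N a : N a -> quotient N (f a).
Proof. by move=> Na; exists a, 1; rewrite oner_eq0 rmorph1 divr1. Qed.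

Lemma quotient_subfield : subfield_closed (quotient S).
Proof.
split; first by rewrite -(rmorph1 f); apply: quotient_id.
split=> [x1 x2 [a [s [Na Ns s0 ->]]] [b [t [Nb Nt t0 ->]]]|x1 [a [s [Na Ns s0 ->]]]].
  have fs0 : f s != 0 by rewrite f_eq0.
  have ft0 : f t != 0 by rewrite f_eq0.
  split.
    exists (a * t - b * s), (s * t); split; rewrite ?mulf_neq0 //.
    - by apply: SB; apply: SM.
    - exact: SM.
    - by rewrite rmorphB !rmorphM /= -[in LHS]mulNr addf_div // mulNr.
  exists (a * b), (s * t); split; rewrite ?mulf_neq0 //; try exact: SM.
  by rewrite !rmorphM /= mulf_div.
have [a0|a0] := eqVneq a 0.
  rewrite a0 rmorph0 mul0r invr0 -(rmorph0 f); apply: quotient_id.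
  by rewrite -[0](subrr 1); apply: SB.
by exists s, a; split; rewrite // invf_div.
Qed.

Lemma quotient_common_denom N (p : nat -> L) n :
  (forall a s, N a -> S s -> N (a * s)) ->
  (forall j, (j < n)%N -> quotient N (p j)) ->
  exists s, [/\ S s, s != 0 &
    forall j, (j < n)%N -> exists2 a, N a & f s * p j = f a].
Proof.
move=> NM; elim: n => [|n IHn] pN.
  by exists 1; split; rewrite ?oner_eq0.
have [j jn|s [sF s0 sN]] := IHn; first by apply: pN; apply: ltnW.
have [a [t [Na tF t0 pE]]] := pN n (leqnn _).
exists (s * t); split; [exact: SM|by rewrite mulf_neq0|].
move=> j; rewrite ltnS leq_eqVlt => /predU1P[->|/sN [b Nb Eb]].
  exists (a * s); first exact: NM.
  by rewrite pE !rmorphM /= -mulrA [f t * _]mulrC divfK ?f_eq0 // mulrC.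
by exists (b * t); [exact: NM|rewrite rmorphM /= mulrAC Eb rmorphM].
Qed.

Lemma quotient_combine c d x :
  quotient S c -> quotient S d -> quotient (fun _ => True) x ->
  quotient (fun _ => True) (c + d * x).
Proof.
move=> [a [s [_ sF s0 ->]]] [b [t [_ tF t0 ->]]] [e [r [_ rF r0 ->]]].
exists (a * (t * r) + (b * e) * s), (s * (t * r)); split=> //.
- by do 2?apply: SM.
- by rewrite !mulf_neq0.
- by rewrite rmorphD !rmorphM /= mulf_div addf_div ?mulf_neq0 ?f_eq0.
Qed.

(** Let s be a common denominator of the coefficients of p, and n = deg p. Then s g is a root of the
    monic polynomial with coefficients s^(n-j) p_j; for j < n, one of the factors s clears the
    denominator of p_j. *)
Lemma quotient_integral (p : {poly L}) g :
  p \is monic -> root p g -> (forall j, quotient (fun _ => True) p`_j) ->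
  exists s, [/\ S s, s != 0 & integralOver f (f s * g)].
Proof.
move=> mp pg pA.
have [//|j _|s [sF s0 sN]] := @quotient_common_denom (fun _ => True) (fun j => p`_j) (size p).
  exact: pA.
exists s; split=> //.
have sp : size p = (size p).-1.+1 by rewrite prednK // size_poly_gt0 monic_neq0.
set n := (size p).-1 in sp.
have pn : p`_n = 1 by apply/eqP; rewrite -monicE.
set q := \poly_(j < n.+1) (f s ^+ (n - j) * p`_j).
have qn : q`_n = 1 by rewrite coef_poly leqnn subnn expr0 mul1r pn.
have sq : size q = n.+1.
  apply/eqP; rewrite eqn_leq size_poly /= ltnNge; apply/negP => sqn.
  by move/eqP: qn; rewrite nth_default // eq_sym oner_eq0.
apply: (@integral_root_monic _ _ _ _ q).
- by rewrite monicE lead_coefE sq qn.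
- rewrite rootE (@horner_coef_wide _ n.+1) ?sq //.
  move/rootP: pg; rewrite (@horner_coef_wide _ n.+1) ?sp // => pg.
  apply/eqP; transitivity (f s ^+ n * \sum_(j < n.+1) p`_j * g ^+ j).
    2: by rewrite pg mulr0.
  rewrite big_distrr /=; apply: eq_bigr => j _; rewrite coef_poly ltn_ord exprMn.
  by rewrite mulrACA -exprD subnK // -ltnS.
- apply/integral_poly => j.
  rewrite coef_poly ltnS; case: ifP => [jn|_]; last exact: integral0.
  move: jn; rewrite leq_eqVlt => /predU1P[->|jn].
    by rewrite subnn expr0 mul1r pn; apply: integral1.
  have [|a _ Ea] := sN j; first by rewrite sp ltnW.
  have -> : f s ^+ (n - j) * p`_j = f (s ^+ (n - j).-1 * a).
    by rewrite rmorphM rmorphXn /= -Ea mulrA -exprSr prednK // subn_gt0.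
  exact: integral_id.
Qed.

End Quotients.

(** * The degree place of K(g), extended to L *)

Lemma leq_size_mul (R : idomainType) (a b c d : {poly R}) :
  c != 0 -> d != 0 -> (size a <= size c)%N -> (size b <= size d)%N ->
  (size (a * b)%R <= size (c * d)%R)%N.
Proof.
move=> c0 d0 ac bd; rewrite [in X in (_ <= X)%N]size_mul //.
apply: leq_trans (size_polyMleq _ _) _; lia.
Qed.

Lemma leq_size_exp (R : idomainType) (a b : {poly R}) n :
  b != 0 -> (size a <= size b)%N -> (size (a ^+ n) <= size (b ^+ n))%N.
Proof.
move=> b0 ab; elim: n => [//|n IHn].
by rewrite !exprS; apply: leq_size_mul; rewrite ?expf_neq0.
Qed.

Section PlaceAtInfinity.
Variables (K L : fieldType) (i : {rmorphism K -> L}) (g : L).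
Local Notation ev p := (map_poly i p).[g].
Hypothesis g_transc : forall p : {poly K}, p != 0 -> ev p != 0.
Hypothesis g_pi : forall x : L, exists2 q, pexp L q & ratval i g (x ^+ q).

(* The valuation ring of L lying over the degree place of K(g). *)
Definition at_infinity (x : L) : Prop :=
  exists q (u v : {poly K}), [/\ pexp L q, v != 0, (size u <= size v)%N & x ^+ q = ev u / ev v].

Let ev_inj (u v : {poly K}) : ev u = ev v -> u = v.
Proof.
move=> E; apply/eqP; rewrite -subr_eq0; apply: contraT => /g_transc.
by rewrite rmorphB !hornerE E subrr eqxx.
Qed.

Let evM u v : ev (u * v) = ev u * ev v. Proof. by rewrite rmorphM hornerM. Qed.
Let evX u n : ev (u ^+ n) = ev u ^+ n. Proof. by rewrite rmorphXn horner_exp. Qed.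
Let evB u v : ev (u - v) = ev u - ev v. Proof. by rewrite rmorphB !hornerE. Qed.

(** The degree condition does not depend on the chosen power of x: two representations give u^q'
    v'^q = u'^q v^q', as g is transcendental, and degrees can be compared. *)
Lemma at_infinity_size x q (u v : {poly K}) :
  at_infinity x -> v != 0 -> (0 < q)%N -> x ^+ q = ev u / ev v ->
  (size u <= size v)%N.
Proof.
move=> [q' [u' [v' [pq' v'0 su'v' Ex']]]] v0 q0 Ex.
have q'0 := pexp_gt0 pq'.
have E : u ^+ q' * v' ^+ q = u' ^+ q * v ^+ q'.
  apply: ev_inj; rewrite !evM !evX; apply/eqP.
  rewrite -eqr_div ?expf_neq0 ?g_transc // -!expr_div_n -Ex -Ex'.
  by rewrite -!exprM mulnC.
have [->|u0] := eqVneq u 0; first by rewrite size_poly0.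
have u'0 : u' != 0.
  apply/eqP => u'0; move: E; rewrite u'0 expr0n gtn_eqF //= mul0r => /eqP.
  by rewrite mulf_eq0 !expf_eq0 (negPf u0) (negPf v'0) !andbF.
have := congr1 (fun p : {poly K} => size p) E.
rewrite !size_mul ?expf_neq0 //.
have sX (p : {poly K}) n : p != 0 -> size (p ^+ n) = ((size p).-1 * n).+1.
  by move=> p0; rewrite -size_exp prednK // size_poly_gt0 expf_neq0.
rewrite !sX // !addSn !addnS /= => -[] E2.
rewrite -!size_poly_gt0 in u0 v0 u'0 v'0.
rewrite leqNgt; apply/negP => suv.
have lt1 : ((size v).-1 * q' < (size u).-1 * q')%N 
  by rewrite ltn_pmul2r // -ltnS !prednK.
have le2 : ((size u').-1 * q <= (size v').-1 * q)%N 
  by rewrite leq_mul2r -ltnS !prednK // su'v' orbT.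
by have := leq_add lt1 le2; rewrite addSn E2 addnC ltnn.
Qed.

Lemma at_infinity_const c : at_infinity (i c).
Proof.
exists 1%N, c%:P, 1; split; rewrite ?oner_eq0 ?size_poly1 ?size_polyC_leq1 //.
  exact: pexp1.
by rewrite expr1 rmorph1 map_polyC !hornerE divr1.
Qed.

(** Both elements are raised to the common exponent q q'. Being a power of the characteristic
    exponent, it is compatible with subtraction, so the fractions are subtracted over a common
    denominator. For nonzero x, comparing deg u with deg v decides between x and 1/x. *)
Lemma at_infinity_valuation : valuation_ring at_infinity.
Proof.
split; first by rewrite -(rmorph0 i); apply: at_infinity_const.
split; first by rewrite -(rmorph1 i); apply: at_infinity_const.
split=> [x y [q [u [v [pq v0 suv Ex]]]] [q' [u' [v' [pq' v'0 suv' Ey]]]]|x x0].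
  have w0 : v ^+ q' * v' ^+ q != 0 by rewrite mulf_neq0 ?expf_neq0.
  have Ex' : x ^+ (q * q') = ev (u ^+ q') / ev (v ^+ q').
    by rewrite exprM Ex expr_div_n !evX.
  have Ey' : y ^+ (q * q') = ev (u' ^+ q) / ev (v' ^+ q).
    by rewrite mulnC exprM Ey expr_div_n !evX.
  have evv : ev (v ^+ q') != 0 by rewrite g_transc ?expf_neq0.
  have evv' : ev (v' ^+ q) != 0 by rewrite g_transc ?expf_neq0.
  split.
    exists (q * q')%N, (u ^+ q' * v' ^+ q - u' ^+ q * v ^+ q'), (v ^+ q' * v' ^+ q).
    split=> //; first exact: pexpM.
      rewrite (leq_trans (size_polyD _ _)) // size_polyN geq_max.
      rewrite [in X in _ && X]mulrC !leq_size_mul ?leq_size_exp ?expf_neq0 //.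
    rewrite pexpB; last exact: pexpM.
    by rewrite Ex' Ey' evB !evM -[in LHS]mulNr addf_div // mulNr.
  exists (q * q')%N, (u ^+ q' * u' ^+ q), (v ^+ q' * v' ^+ q); split=> //.
  - exact: pexpM.
  - by rewrite leq_size_mul ?leq_size_exp ?expf_neq0.
  - by rewrite exprMn Ex' Ey' mulf_div !evM.
have [q pq [u [v [v0 Ex]]]] := g_pi x.
have v0' : v != 0 by apply: contraNneq v0 => ->; rewrite rmorph0 horner0.
have u0 : u != 0.
  apply: contraNneq x0 => u0; move/eqP: Ex.
  by rewrite u0 rmorph0 horner0 mul0r expf_eq0 => /andP[].
case/orP: (leq_total (size u) (size v)) => suv; [left|right].
  by exists q, u, v.
by exists q, v, u; rewrite exprVn Ex invf_div.
Qed.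

Lemma not_at_infinity_gen : ~ at_infinity g.
Proof.
move=> /(@at_infinity_size _ 1 'X 1); rewrite oner_eq0 size_polyX size_poly1.
by move=> /(_ isT isT); rewrite rmorph1 map_polyX !hornerE divr1 => /(_ erefl).
Qed.

Lemma at_infinity_residue x : at_infinity x ->
  exists2 q, pexp L q & exists c, val_max_ideal at_infinity (x ^+ q - i c).
Proof.
move=> [q [u [v [pq v0 suv Ex]]]]; exists q => //.
set m := (size v).-1.
have sv : size v = m.+1 by rewrite prednK // size_poly_gt0.
have lv0 : lead_coef v != 0 by rewrite lead_coef_eq0.
set c := u`_m / lead_coef v; exists c.
set r := u - c *: v.
have sr : (size r <= m)%N.
  apply/leq_sizeP => j; rewrite leq_eqVlt coefB coefZ => /predU1P[<-|mj].
    by rewrite divfK // subrr.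
  by rewrite !nth_default ?mulr0 ?subr0 // ?sv // (leq_trans suv) // sv.
have Er : x ^+ q - i c = ev r / ev v.
  rewrite evB mulrBl -Ex map_polyZ hornerZ mulfK //; exact: g_transc.
split.
  rewrite Er; exists 1%N, r, v; split=> //; first exact: pexp1.
  by rewrite sv leqW.
have [w0|w0] := eqVneq (x ^+ q - i c) 0; [by left|right].
have r0 : r != 0.
  by apply: contraNneq w0 => r0; rewrite Er r0 rmorph0 horner0 mul0r.
move=> /(@at_infinity_size _ 1 v r); rewrite expr1 Er invf_div.
by move=> /(_ r0 isT erefl); rewrite sv leqNgt ltnS sr.
Qed.

End PlaceAtInfinity.

(** * Purely inseparable extensions of K(G) *)

Section Adjunction.
Variables (L : fieldType) (E : L -> Prop).

Definition adj (G : L) : L -> Prop := genfield (fun y => E y \/ y = G).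
Definition pure_insep_over (D : L -> Prop) : Prop :=
  forall x, exists2 q, pexp L q & D (x ^+ q).

Lemma adj_subfield G : subfield_closed (adj G).
Proof. exact: genfield_subfield. Qed.

Lemma adj_genfield G x : genfield E x -> adj G x.
Proof.
move=> Ex; apply: (genfield_sub (adj_subfield G) _ Ex) => y Ey.
by apply: genfield_id; left.
Qed.

Lemma adj_gen G : adj G G. Proof. by apply: genfield_id; right. Qed.

Lemma adj_sub G (S : L -> Prop) : subfield_closed S ->
  (forall x, E x -> S x) -> S G -> forall x, adj G x -> S x.
Proof. by move=> SS ES SG x; apply: genfield_sub => // y [/ES|->]. Qed.

Lemma adj_ratval G x : adj G x -> ratval (val : gensub E -> L) G x.
Proof.
move=> aGx; apply: (adj_sub (ratval_subfield _ G) _ _ aGx); last exact: ratval_gen.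
by move=> y Ey; have [c ->] := in_gsval (genfield_id Ey); apply: ratval_const.
Qed.

Lemma subfield_pexp (S : L -> Prop) q : pexp L q -> subfield_closed S ->
  subfield_closed (fun x => S (x ^+ q)).
Proof.
move=> pq SS; have [S1 [SBM SV]] := SS.
split; first by rewrite expr1n.
split=> [x y Sx Sy|x Sx]; last by rewrite exprVn; apply: SV.
by rewrite pexpB // exprMn; apply: SBM.
Qed.

(** The x with x^q in K(G^q) form a subfield, since q-th powers respect subtraction, and it contains
    K and G. *)
Lemma adj_pexp G q x : pexp L q -> adj G x -> adj (G ^+ q) (x ^+ q).
Proof.
move=> pq aGx.
have SS := subfield_pexp pq (adj_subfield (G ^+ q)).
refine (adj_sub SS _ (@adj_gen _) aGx) => y Ey.
by apply: (subfieldX q (adj_subfield _)); apply: adj_genfield; apply: genfield_id.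
Qed.

Lemma pure_insep_adj_pexp G q : pexp L q ->
  pure_insep_over (adj G) -> pure_insep_over (adj (G ^+ q)).
Proof.
move=> pq piG x; have [r pr aG] := piG x.
by exists (r * q)%N; [exact: pexpM|rewrite exprM; apply: adj_pexp].
Qed.

Lemma pure_insep_adj_sub G G' : adj G' G -> pure_insep_over (adj G) -> pure_insep_over (adj G').
Proof.
move=> aG piG x; have [r pr aGx] := piG x; exists r => //.
apply: (adj_sub (adj_subfield G') _ aG aGx) => y Ey.
by apply: adj_genfield; apply: genfield_id.
Qed.

Lemma pole_generator (O : L -> Prop) G :
  valuation_ring O -> (forall y, genfield E y -> O y) -> (exists z, ~ O z) ->
  pure_insep_mod O (genfield E) (val_max_ideal O) -> pure_insep_over (adj G) ->
  exists2 G', ~ O G' & pure_insep_over (adj G').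
Proof.
move=> vO KO [z nOz] resO piG.
have [OG|nOG] := EM (O G); last by exists G.
have [p [e [pP [c [Kc [Om mP]]]]]] := resO G OG.
have pq : pexp L (p ^ e) by exists p, e.
set q := (p ^ e)%N in pq Om mP; have piGq := pure_insep_adj_pexp pq piG.
(* If G^q = c, then K(G^q) = K is inside O, so every z has a power in O and hence lies in O, against
   O being proper. *)
have [w0|w0] := eqVneq (G ^+ q - c) 0.
  case: nOz; have [r pr az] := piGq z.
  apply: (val_ring_root vO (pexp_gt0 pr)); apply: KO.
  apply: (adj_sub (genfield_subfield E) _ _ az); first by move=> y Ey; apply: (genfield_id Ey).
  by rewrite (subr0_eq w0).
exists (G ^+ q - c)^-1; first by case: mP => // w_eq0; rewrite w_eq0 eqxx in w0.
(* G^q = 1/G' + c, so K(G') contains K(G^q). *)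
apply: pure_insep_adj_sub piGq.
have aw := subfieldV (adj_subfield _) (@adj_gen (G ^+ q - c)^-1).
rewrite invrK in aw.
by have := subfieldD (adj_subfield _) aw (adj_genfield Kc); rewrite subrK.
Qed.

(** y^q keeps the pole of y, which forces deg u > deg v in y^q = u(G)/v(G). For y in S^-1 A, the
    coefficients c + d y^q are in S^-1 A too. *)
Lemma pole_generator_integral (O : L -> Prop) G y :
  valuation_ring O -> (forall y, genfield E y -> O y) -> ~ O G -> ~ O y ->
  pure_insep_over (adj G) ->
  exists q p, [/\ p \is monic, root p G & forall j, exists c d,
    [/\ genfield E c, genfield E d & p`_j = c + d * y ^+ q]].
Proof.
move=> vO KO nOG nOy piG; have [q pq aGy] := piG y.
have nOyq : ~ O (y ^+ q) by move=> /(val_ring_root vO (pexp_gt0 pq)).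
have [u [v [v0 Ey]]] := adj_ratval aGy.
have KO' (c : gensub E) : O (val c) by apply: KO; apply: (@gsval_in _ E c).
have suv : (size v < size u)%N by apply: (val_pole_size vO KO' nOG v0); rewrite -Ey.
have [p [mp pG pE]] := pole_integral suv v0 Ey.
exists q, p; split=> // j; have [c [d ->]] := pE j.
by exists (val c), (val d); split; [exact: gsval_in|exact: gsval_in|].
Qed.

Lemma infinity_valuation G :
  ~ algebraicOver (val : gensub E -> L) G -> pure_insep_over (adj G) ->
  exists O : L -> Prop, [/\ valuation_ring O, forall y, genfield E y -> O y,
    ~ O G & pure_insep_mod O (genfield E) (val_max_ideal O)].
Proof.
move=> trG piG.
have tr p : p != 0 -> (map_poly (val : gensub E -> L) p).[G] != 0.
  by move=> p0; apply/negP => /eqP pG; apply: trG; exists p => //; apply/rootP.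
have rvG x : exists2 q, pexp L q & ratval (val : gensub E -> L) G (x ^+ q).
  by have [q pq aG] := piG x; exists q => //; apply: adj_ratval.
exists (at_infinity (val : gensub E -> L) G); split.
- exact: at_infinity_valuation.
- by move=> y /in_gsval[c ->]; apply: at_infinity_const.
- exact: not_at_infinity_gen.
- move=> x /(at_infinity_residue tr)[q [p [e [pP ->]]] [c mc]].
  by exists p, e; split=> //; exists (val c); split=> //; apply: gsval_in.
Qed.

(** This serves to show that G is transcendental. Algebraic elements form a subfield, so all of K(G)
    would be algebraic; if p annihilates x^q, then p(T^q) annihilates x. *)
Lemma pure_insep_algebraic G : algebraicOver (val : gensub E -> L) G ->
  pure_insep_over (adj G) -> forall x, algebraicOver (val : gensub E -> L) x.
Proof.
move=> algG piG x; have [q pq aGx] := piG x.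
have [p p0 px] : algebraicOver (val : gensub E -> L) (x ^+ q).
  apply: (adj_sub _ _ algG aGx).
    split; first exact: algebraic1.
    split=> [y z ay az|y ay]; last exact: algebraic_inv.
    by split; [exact: algebraic_sub|exact: algebraic_mul].
  by move=> y Ey; have [c ->] := in_gsval (genfield_id Ey); apply: algebraic_id.
exists (p \Po 'X^q).
  by rewrite comp_poly_eq0 // size_polyXn ltnS (pexp_gt0 pq).
by rewrite rootE map_comp_poly map_polyXn horner_comp hornerXn -rootE.
Qed.

End Adjunction.

(** * The ring k[F], the field k(F) and algebraic relations over it *)

Definition evalF (k : fieldType) (F : {poly {poly k}}) :
  {rmorphism {poly k} -> {poly {poly k}}} := comp_poly F \o map_poly polyC.

Lemma evalFE (k : fieldType) (F : {poly {poly k}}) q : evalF F q = q^:P \Po F.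
Proof. by []. Qed.

Lemma evalFX (k : fieldType) (F : {poly {poly k}}) : evalF F 'X = F.
Proof. by rewrite evalFE map_polyX comp_polyX. Qed.

Lemma evalFC (k : fieldType) (F : {poly {poly k}}) c : evalF F c%:P = c%:P%:P.
Proof. by rewrite evalFE map_polyC comp_polyC. Qed.

Lemma in_kF_polyP (k : fieldType) (F s : {poly {poly k}}) :
  in_kF_poly F s <-> exists q : {poly k}, s = evalF F q.
Proof.
have E q : (map_poly (fun c : k => c%:P%:P) q).[F] = evalF F q.
  by rewrite evalFE /comp_poly -map_poly_comp.
by split=> -[q ->]; exists q; rewrite E.
Qed.

Lemma in_kF_poly1 (k : fieldType) (F : {poly {poly k}}) : in_kF_poly F 1.
Proof. by apply/in_kF_polyP; exists 1; rewrite rmorph1. Qed.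

Lemma in_kF_polyB (k : fieldType) (F s t : {poly {poly k}}) :
  in_kF_poly F s -> in_kF_poly F t -> in_kF_poly F (s - t).
Proof.
move=> /in_kF_polyP[q ->] /in_kF_polyP[r ->]; apply/in_kF_polyP.
by exists (q - r); rewrite rmorphB.
Qed.

Lemma in_kF_polyM (k : fieldType) (F s t : {poly {poly k}}) :
  in_kF_poly F s -> in_kF_poly F t -> in_kF_poly F (s * t).
Proof.
move=> /in_kF_polyP[q ->] /in_kF_polyP[r ->]; apply/in_kF_polyP.
by exists (q * r); rewrite rmorphM.
Qed.

HB.instance Definition _ (k : fieldType) :=
  GRing.RMorphism.copy (@toF k) (@FracField.tofrac {poly {poly k}}).

Lemma toF_inj (k : fieldType) : injective (@toF k).
Proof. by move=> a b /eqP; rewrite tofrac_eq => /eqP. Qed.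

Definition kF_gen (k : fieldType) (F : {poly {poly k}}) (y : fracA k) : Prop :=
  kconst y \/ y = toF F.

Lemma kF_toF (k : fieldType) (F s : {poly {poly k}}) :
  in_kF_poly F s -> kF F (toF s).
Proof.
move=> /in_kF_polyP[q ->]; have SS : subfield_closed (kF F) by apply: genfield_subfield.
elim/poly_ind: q => [|q c IHq].
  by apply: genfield_id; left; exists 0; rewrite !rmorph0.
rewrite !rmorphD !rmorphM evalFX evalFC.
apply: (subfieldD SS); first apply: (subfieldM SS IHq).
  by apply: genfield_id; right.
by apply: genfield_id; left; exists c.
Qed.

Definition kF_quot (k : fieldType) (F : {poly {poly k}}) (N : {poly {poly k}} -> Prop)
    (x : fracA k) :=
  @quotient {poly {poly k}} (fracA k) (@toF k) (in_kF_poly F) N x.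

Lemma kF_quotient (k : fieldType) (F : {poly {poly k}}) x :
  kF F x -> kF_quot F (in_kF_poly F) x.
Proof.
move=> kx; apply: (genfield_sub _ _ kx) => {x kx} [|y [[c ->]|->]].
- by apply: quotient_subfield (@toF_inj k) _ _ _ _;
    [exact: in_kF_poly1|exact: in_kF_polyB|exact: in_kF_polyM].
- apply: (quotient_id _ (@in_kF_poly1 _ F)).
  by apply/in_kF_polyP; exists c%:P; rewrite evalFC.
- apply: (quotient_id _ (@in_kF_poly1 _ F)).
  by apply/in_kF_polyP; exists 'X; rewrite evalFX.
Qed.

Lemma locA_quotient (k : fieldType) (F : {poly {poly k}}) x :
  locA F x <-> kF_quot F (fun _ => True) x.
Proof.
by split=> [[a [s [sF [s0 ->]]]]|[a [s [_ sF s0 ->]]]]; exists a, s.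
Qed.

(** A common denominator moves the coefficients from k(F) to k[F], where they are lifted to k[T].
    Nonvanishing is asserted after substituting F, as [evalF F] is not injective for constant F. *)
Lemma algebraic_kF_relation (k : fieldType) (F a : {poly {poly k}}) :
  algebraicOver (val : gensub (kF_gen F) -> fracA k) (toF a) ->
  exists2 q : {poly {poly k}}, map_poly (evalF F) q != 0 & (map_poly (evalF F) q).[a] = 0.
Proof.
move=> [p p0 /rootP pa].
have pK j : (j < size p)%N -> kF_quot F (in_kF_poly F) (val p`_j).
  by move=> _; apply: kF_quotient; apply: gsval_in.
have [s [sF s0 sN]] := @quotient_common_denom {poly {poly k}} (fracA k) (@toF k)
  (@toF_inj k) (in_kF_poly F) (in_kF_poly1 F) (@in_kF_polyM k F) (in_kF_poly F)
  (fun j => val p`_j) (size p) (@in_kF_polyM k F) pK.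
have /choice[h hE] : forall j, exists b, toF s * val p`_j = toF (evalF F b).
  move=> j; have [jp|jp] := ltnP j (size p).
    by have [b /in_kF_polyP[c ->] ->] := sN j jp; exists c.
  by exists 0; rewrite nth_default // !rmorph0 mulr0.
pose q := \poly_(j < size p) h j; exists q.
all: have qE : map_poly (@toF k) (map_poly (evalF F) q) = toF s *: map_poly val p.
1,3: apply/polyP => j; rewrite !(coef_map, coefZ) /= coef_poly hE; case: ltnP => // jp.
1,2: by apply/esym; rewrite -hE nth_default // !rmorph0 mulr0.
  apply/eqP => q0; move: qE; rewrite q0 rmorph0 => /esym/eqP.
  by rewrite scaler_eq0 map_poly_eq0 (negPf p0) orbF tofrac_eq0 (negPf s0).
by apply: (@toF_inj k); rewrite -horner_map /= qE hornerZ pa mulr0 rmorph0.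
Qed.

(** This turns a relation for X over k[F] into a relation for F over k[X]. *)
Lemma comp_swapXY (k : fieldType) (F q : {poly {poly k}}) :
  swapXY q \Po F = (map_poly (evalF F) q).['X%:P].
Proof.
elim/poly_ind: q => [|q c IHq]; first by rewrite !rmorph0 horner0.
rewrite !rmorphD !rmorphM /= swapXY_X swapXY_polyC comp_polyC IHq.
by rewrite map_polyX map_polyC hornerD hornerMX hornerC.
Qed.

Lemma evalF_const (k : fieldType) (f c : {poly k}) : evalF f%:P c = (c \Po f)%:P.
Proof.
elim/poly_ind: c => [|c d IHc]; first by rewrite !rmorph0.
by rewrite !rmorphD !rmorphM evalFX evalFC IHc /= comp_polyX comp_polyC.
Qed.

(* If F involves Y and X is algebraic over k(F), then F is algebraic over
   k(X), which is impossible by Y-degree.  If F is in k[X], then Y is not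
   algebraic over k(F). *)
Lemma not_algebraic_kF (k : fieldType) (F : {poly {poly k}}) :
  ~ (forall a, algebraicOver (val : gensub (kF_gen F) -> fracA k) (toF a)).
Proof.
move=> alg; have [F1|F1] := leqP (size F) 1.
  have [q q0] := algebraic_kF_relation (alg 'X).
  (* As F is in k[X], so are the coefficients of the relation for Y; evaluating it at Y returns the
     same nonzero polynomial. *)
  have EQ : map_poly (evalF F) q = (map_poly (comp_poly F`_0) q)^:P.
    rewrite -map_poly_comp; apply: eq_map_poly => c.
    by rewrite {1}(size1_polyC F1) evalF_const.
  rewrite EQ => /eqP; rewrite -[_.['X]]/(_ \Po 'X) comp_polyXr => /eqP Q0.
  by rewrite EQ Q0 rmorph0 eqxx in q0.
have [q q0] := algebraic_kF_relation (alg 'X%:P).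
rewrite -comp_swapXY => /eqP; rewrite comp_poly_eq0 // swapXY_eq0 => /eqP q_eq0.
by rewrite q_eq0 rmorph0 eqxx in q0.
Qed.

(** * Good pseudo field generators and purely inseparable dicriticals *)

Lemma frac_pure_insepP (k : fieldType) (D D' : fracA k -> Prop) :
  (forall x, D x -> D' x) -> frac_pure_insep D -> pure_insep_over D'.
Proof.
move=> DD' piD x; have [p [e [pP [c [Dc E]]]]] := piD x I.
exists (p ^ e)%N; first by exists p, e.
by rewrite (subr0_eq E); apply: DD'.
Qed.

Lemma frac_pure_insepW (k : fieldType) (D D' : fracA k -> Prop) :
  (forall x, D x -> D' x) -> pure_insep_over D -> frac_pure_insep D'.
Proof.
move=> DD' piD x _; have [q [p [e [pP ->]]] Dx] := piD x.
by exists p, e; split=> //; exists (x ^+ (p ^ e)%N); split; [exact: DD'|rewrite subrr].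
Qed.

Theorem mainTheorem3 (k : closedFieldType) (F : {poly {poly k}}) :
  pseudo_field_generator F ->
  (good_pseudo_field_generator F <->
   exists O : fracA k -> Prop, purely_insep_dicritical F O).
Proof.
move=> [G0 piG0]; split=> [[G piG]|[O [[vO [KO [ntO [a [aA nOa]]]]] resO]]].
  have piG' : pure_insep_over (adj (kF_gen F) (toF G)).
    by apply: frac_pure_insepP piG => x; apply: genfield_mono => y; rewrite /kF_gen; tauto.
  have [|O [vO KO nOG resO]] := @infinity_valuation _ _ (toF G) _ piG'.
    move=> algG; apply: (@not_algebraic_kF _ F) => a.
    exact: pure_insep_algebraic algG piG' _.
  (* G, written G/1 in the localization, witnesses both that O is proper and that O does not contain
     the localization. *)
  exists O; split=> //; split=> //; split=> //; split; first by exists (toF G).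
  exists (toF G); split=> //; exists G, 1.
  by rewrite oner_eq0 rmorph1 divr1; split=> //; exact: in_kF_poly1.
have piG1 : pure_insep_over (adj (kF_gen F) G0).
  by apply: frac_pure_insepP piG0 => x; apply: genfield_mono => y; rewrite /kF_gen; tauto.
have [G nOG piG] := @pole_generator _ (kF_gen F) O G0 vO KO ntO resO piG1.
have [q [p [mp pG pE]]] := @pole_generator_integral _ _ _ _ _ vO KO nOG nOa piG.
have in1 := in_kF_poly1 F; have inM := @in_kF_polyM k F.
have aqA : kF_quot F (fun _ => True) (a ^+ q).
  move/locA_quotient: aA => [b [s [_ sF s0 ->]]].
  exists (b ^+ q), (s ^+ q); split; rewrite ?expf_neq0 ?rmorphXn ?expr_div_n //.
  elim: (q) => [//|n IHn]; rewrite exprS; exact: inM.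
(* G is integral over the localization, so s G is integral over A for some nonzero s in k[F]. *)
have [|s [sF s0 intG]] := @quotient_integral {poly {poly k}} (fracA k) (@toF k)
  (@toF_inj k) _ in1 inM p G mp pG.
  move=> j; have [c [d [/kF_quotient Kc /kF_quotient Kd ->]]] := pE j.
  exact (quotient_combine (@toF_inj k) inM Kc Kd aqA).
have [H HE] := integral_poly_frac intG.
exists H; apply: (@frac_pure_insepW _ (adj (kF_gen F) (toF H))).
  by move=> x; apply: genfield_mono => y; rewrite /kF_gen; tauto.
(* G = H/s with s in k(F), so adjoining H to k(F) recovers G. *)
apply: pure_insep_adj_sub piG.
have ts0 : toF s != 0 by rewrite tofrac_eq0.
have -> : G = (toF s)^-1 * toF H by rewrite /toF -HE mulKf.
have SS := adj_subfield (kF_gen F) (toF H).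
apply: (subfieldM SS); last exact: (@adj_gen _ _ (toF H)).
by apply: (subfieldV SS); apply: adj_genfield; apply: kF_toF.
Qed.
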